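(* Let $d\ge 2$ and $k\ge 1$ be integers. The subgraph induced in $\Lambda(d,k)$ by the simplices (polytopes with $d+1$ vertices) and the polytopes with $d+2$ vertices is connected.
   Context: A lattice polytope is a polytope whose vertices all belong to $\mathbb{Z}^d$. Let $P\subset\mathbb{R}^d$ be a $d$-dimensional polytope with vertex set $\mathcal{V}$. A point $x\in\mathbb{R}^d\setminus P$ can be inserted in $P$ if the vertex set of the convex hull of $P\cup\{x\}$ is exactly $\mathcal{V}\cup\{x\}$; the insertion move then replaces $P$ by this convex hull. A vertex $v\in\mathcal{V}$ can be deleted from $P$ if the convex hull of $\mathcal{V}\setminus\{v\}$ is still $d$-dimensional; the deletion move then replaces $P$ by this convex hull. $\Lambda(d,k)$ is the undirected graph whose vertices are the $d$-dimensional lattice polytopes contained in the hypercube $[0,k]^d$ and whose edges connect two such polytopes when one is obtained from the other by a single insertion move (equivalently, the other by a single deletion move). *)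

(* Defs.v *)
From Stdlib Require Import Relation_Operators.
From mathcomp Require Import all_boot all_order all_algebra.
From mathcomp Require Import boolp classical_sets functions cardinality.
From mathcomp Require Import reals convex.

Set Implicit Arguments.
Unset Strict Implicit.
Unset Printing Implicit Defensive.

Import Order.TTheory GRing.Theory Num.Theory.

Local Open Scope classical_set_scope.
Local Open Scope card_scope.
Local Open Scope ring_scope.

Section Graphs.
Variable T : Type.

Record graph := Graph {
  gvertex : set T;
  gedge : T -> T -> Prop }.

Definition induced_subgraph (G : graph) (W : set T) : graph :=
  Graph (gvertex G `&` W)
        (fun x y => [/\ W x, W y & gedge G x y]).

Definition graph_connected (G : graph) : Prop :=
  gvertex G !=set0 /\
  forall x y, gvertex G x -> gvertex G y -> clos_refl_trans T (gedge G) x y.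

End Graphs.

Section Polytopes.
Variables (R : realType) (d : nat).
Implicit Types (A S P Q V : set 'rV[R]_d) (x y v : 'rV[R]_d).

Definition convex_hull S : set 'rV[R]_d := smallest (@convex_set R 'rV[R]_d) S.

Definition affine_set A : Prop :=
  forall x y (t : R), A x -> A y -> A (t *: x + (1 - t) *: y).

Definition affine_hull S : set 'rV[R]_d := smallest affine_set S.

(* The affine hull is a translate of the row space of a rank n matrix.  The
   empty set has no dimension in this sense. *)
Definition has_dim S (n : nat) : Prop :=
  exists (x0 : 'rV[R]_d) (U : 'M[R]_d),
    \rank U = n /\ affine_hull S = [set x | (x - x0 <= U)%MS].

Definition polytope P : Prop := exists2 V, finite_set V & P = convex_hull V.

(* Vertices are the extreme points. *)
Definition vertices P : set 'rV[R]_d :=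
  [set v | P v /\ forall x y (t : R), P x -> P y -> 0 < t < 1 ->
             v = t *: x + (1 - t) *: y -> x = v /\ y = v].

Definition has_vertex_count P (n : nat) : Prop := vertices P #= `I_n.

Definition lattice_polytope P : Prop :=
  polytope P /\ forall v, vertices P v -> v \is a mxOver Num.int.

Definition hypercube (k : nat) : set 'rV[R]_d :=
  [set x | forall i, 0 <= x ord0 i <= k%:R].

Definition can_insert P x : Prop :=
  ~ P x /\ vertices (convex_hull (P `|` [set x])) = vertices P `|` [set x].

Definition insertion_move P Q : Prop :=
  exists2 x, can_insert P x & Q = convex_hull (P `|` [set x]).

Definition Lambda_vertex (k : nat) : set (set 'rV[R]_d) :=
  [set P | [/\ lattice_polytope P, has_dim P d & P `<=` hypercube k]].

Definition Lambda (k : nat) : graph (set 'rV[R]_d) :=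
  Graph (Lambda_vertex k)
        (fun P Q => [/\ Lambda_vertex k P, Lambda_vertex k Q
                      & insertion_move P Q \/ insertion_move Q P]).

End Polytopes.

Arguments Lambda R d k : clear implicits.

(* Main.v *)
Require Import Defs.
From Stdlib Require Import Relation_Operators.
From mathcomp Require Import all_boot all_order all_algebra.
From mathcomp Require Import boolp classical_sets functions cardinality.
From mathcomp Require Import interval_inference reals convex.
From mathcomp Require Import ring lra.

Set Implicit Arguments.
Unset Strict Implicit.
Unset Printing Implicit Defensive.

Import Order.TTheory GRing.Theory Num.Theory.

Local Open Scope classical_set_scope.
Local Open Scope ring_scope.

(** Let S be a lattice simplex with vertices p 0, ..., p d, and write a further
    lattice point x in barycentric coordinates with respect to S.  The d+2 points
    p 0, ..., p d, x are the vertices of a polytope exactly when both sides of their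
    affine dependence contain at least two points, that is, when two coordinates of
    x are positive and one is negative ([insertable], [vertices_insert]).  Inserting
    such an x and then deleting any p v whose coordinate at x is nonzero leads to
    another simplex: this is an exchange ([linked_replace]).  A polytope with d+2
    vertices is adjacent to a simplex ([linked_simplex]), so it is enough to connect
    simplices by exchanges.  All of them are brought to one simplex whose vertices
    are corners of the cube.

    Call one coordinate h of the space the height; as d >= 2, there is another
    coordinate.  A given simplex has a vertex t of maximal height M and a vertex b of
    minimal height m < M.

    The heart of the proof is to remove the vertices v strictly between these two
    slices ([two_slices_step]).  Since the coordinate of v vanishes at t and at b, it
    is not a function of the height alone, so some horizontal unit vector e changes
    it.  Suppose that no vertex of the two slices can be shifted by e or by -e so as to
    give a point that may be exchanged for v.  Let mu be the vector of increments of the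
    barycentric coordinates under a shift by e.  A failed shift t + e forces
    mu t <= -1 and a single positive entry mu j; a failed shift b - e would likewise
    force mu b >= 1, with b different from j, which is absurd.  Hence t, b and likewise
    all the vertices of the two slices lie on the same wall of the cube orthogonal to e
    and can be moved in one direction only, say by e.  Then mu t and mu b are at most
    -1, so mu j >= 2.  The increments satisfy: sum over l of mu l times (distance of p l to the wall) = 1.  As distances
    are integers, the term of j is at least 2, unless it is zero, and then the sum
    would not be positive; so some l has mu l < 0 and p l is off the wall, hence strictly
    between the two slices.  The point p l - e can be inserted, and it can replace p l,
    because t, l have positive coordinates and j a negative one.  This brings p l closer
    to t, so the process terminates ([reach_two_slices]).

    When all the vertices are in two slices, the vertices of one slice but one can
    be replaced by corners of the other slice ([reach_pyramid]).  The simplex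
    is then a pyramid, and its apex can be exchanged freely within its slice, then
    for a corner of the cube in the farthest horizontal facet ([reach_apex]).
    Applying the two operations downwards, then upwards, leaves only corners
    ([reach_corners]).  Finally, every insertion of a corner into a simplex made of
    corners is possible, so basis exchange connects such simplices
    ([reach_corner_frame]). *)

(** * Affine functions and barycentric coordinates *)

Section Barycentric.
Variables (R : realType) (d : nat).
Local Notation point := 'rV[R]_d.
Implicit Types (x y u : point) (f g : point -> R) (p q : 'I_d.+1 -> point).

Definition affine_fun f := forall n (c : 'I_n -> R) (z : 'I_n -> point),
  \sum_i c i = 1 -> f (\sum_i c i *: z i) = \sum_i c i * f (z i).

Lemma affine_fun2 f x y (t : R) :
  affine_fun f -> f (t *: x + (1 - t) *: y) = t * f x + (1 - t) * f y.
Proof.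
move=> fA.
have := fA 2%N (fun i => if i == ord0 then t else 1 - t)
  (fun i => if i == ord0 then x else y).
rewrite !big_ord_recl !big_ord0 /= !addr0 => -> //.
by rewrite subrKC.
Qed.

Lemma affine_fun_cst (a : R) : affine_fun (fun=> a).
Proof. by move=> n c z c1; rewrite -mulr_suml c1 mul1r. Qed.

Lemma affine_fun_coord (i : 'I_d) : affine_fun (fun x => x ord0 i).
Proof.
by move=> n c z _; rewrite summxE; apply: eq_bigr => j _; rewrite mxE.
Qed.

Lemma affine_funD f g :
  affine_fun f -> affine_fun g -> affine_fun (fun x => f x + g x).
Proof.
move=> fA gA n c z c1; rewrite fA // gA // -big_split /=.
by apply: eq_bigr => i _; rewrite mulrDr.
Qed.

Lemma affine_funZ (a : R) f : affine_fun f -> affine_fun (fun x => a * f x).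
Proof.
move=> fA n c z c1; rewrite fA // mulr_sumr.
by apply: eq_bigr => i _; rewrite mulrCA.
Qed.

Lemma affine_funB f g :
  affine_fun f -> affine_fun g -> affine_fun (fun x => f x - g x).
Proof.
move=> fA gA n c z c1; rewrite fA // gA // -sumrB.
by apply: eq_bigr => i _; rewrite mulrBr.
Qed.

Lemma affine_fun_sum n (f : 'I_n -> point -> R) :
  (forall i, affine_fun (f i)) -> affine_fun (fun x => \sum_i f i x).
Proof.
move=> fA m c z c1; under eq_bigr => i _ do rewrite fA //.
by rewrite exchange_big /=; apply: eq_bigr => i _; rewrite mulr_sumr.
Qed.

Definition homog x : 'rV[R]_(1 + d) := row_mx 1 x.

Definition frame_mx p : 'M[R]_(1 + d) := \matrix_(i < 1 + d) homog (p i).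

(** The d+1 points are affinely independent, as their homogeneous coordinates
    form an invertible matrix. *)
Definition frame p := frame_mx p \in unitmx.

Definition bary p (i : 'I_d.+1) x : R := (homog x *m invmx (frame_mx p)) ord0 i.

(** The linear part of a barycentric coordinate. *)
Definition slope p (i : 'I_d.+1) u : R := bary p i u - bary p i 0.

Lemma homog_l x : homog x ord0 (lshift d ord0) = 1.
Proof. by rewrite row_mxEl mxE eqxx. Qed.

Lemma homog_r x l : homog x ord0 (rshift 1 l) = x ord0 l.
Proof. by rewrite row_mxEr. Qed.

Lemma homog_sum n (c : 'I_n -> R) (z : 'I_n -> point) :
  \sum_i c i = 1 -> homog (\sum_i c i *: z i) = \sum_i c i *: homog (z i).
Proof.
move=> c1; apply/rowP => j; rewrite summxE.
case: (split_ordP j) => k ->{j}; first rewrite ord1 homog_l -c1.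
  by apply: eq_bigr => i _; rewrite [RHS]mxE homog_l mulr1.
rewrite homog_r summxE; apply: eq_bigr => i _.
by rewrite [RHS]mxE homog_r mxE.
Qed.

Lemma affine_fun_bary p i : affine_fun (bary p i).
Proof.
move=> n c z c1; rewrite /bary homog_sum // mulmx_suml summxE.
by apply: eq_bigr => j _; rewrite -scalemxAl mxE.
Qed.

Lemma bary_add p i x u : bary p i (x + u) = bary p i x + slope p i u.
Proof.
have h : homog x + homog u = homog (x + u) + homog 0.
  by rewrite /homog !add_row_mx addr0.
have := congr1 (fun z => (z *m invmx (frame_mx p)) ord0 i) h.
by rewrite !mulmxDl !mxE /slope /bary !mxE addrA => ->; rewrite addrK.
Qed.

Lemma slopeZ p i (a : R) u : slope p i (a *: u) = a * slope p i u.
Proof.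
have := affine_fun2 u 0 a (affine_fun_bary p i); rewrite scaler0 addr0 /slope => ->.
by ring.
Qed.

Lemma slopeD p i u v : slope p i (u + v) = slope p i u + slope p i v.
Proof. by rewrite {1}/slope bary_add -[u in LHS]add0r bary_add; ring. Qed.

Lemma slope0 p i : slope p i 0 = 0. Proof. by rewrite /slope subrr. Qed.

Section Frame.
Variables (p : 'I_d.+1 -> point) (pF : frame p).

Lemma bary_homog x : \sum_i bary p i x *: homog (p i) = homog x.
Proof.
rewrite -[RHS](mulmxKV pF) mulmx_sum_row; apply: eq_bigr => i _.
by rewrite rowK.
Qed.

Lemma bary_sum1 x : \sum_i bary p i x = 1.
Proof.
have /rowP /(_ (lshift d ord0)) := bary_homog x.
rewrite summxE homog_l => <-.
by apply: eq_bigr => i _; rewrite [RHS]mxE homog_l mulr1.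
Qed.

Lemma bary_comb x : \sum_i bary p i x *: p i = x.
Proof.
have h := bary_homog x; rewrite -homog_sum ?bary_sum1 // in h.
by case/eq_row_mx: h.
Qed.

Lemma affine_fun_bary_comb f x : affine_fun f ->
  f x = \sum_i bary p i x * f (p i).
Proof. by move=> fA; rewrite -{1}[x]bary_comb fA // bary_sum1. Qed.

Lemma bary_vertex i j : bary p i (p j) = (i == j)%:R.
Proof.
have := @mulmxV _ _ (frame_mx p) pF => /matrixP /(_ j i).
rewrite [RHS]mxE eq_sym => <-.
rewrite /bary -[homog _](@rowK _ _ _ (fun i => homog (p i)) j) -row_mul.
by rewrite mxE.
Qed.

Lemma bary_unique (c : 'I_d.+1 -> R) x i :
  \sum_i c i = 1 -> \sum_i c i *: p i = x -> bary p i x = c i.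
Proof.
move=> c1 <-; rewrite (affine_fun_bary p i) // (bigD1 i) //=.
rewrite bary_vertex eqxx mulr1 big1 ?addr0 // => j ji.
by rewrite bary_vertex eq_sym (negbTE ji) mulr0.
Qed.

Lemma affine_fun_eq0 f : affine_fun f -> (forall i, f (p i) = 0) ->
  forall x, f x = 0.
Proof.
move=> fA f0 x; rewrite affine_fun_bary_comb // big1 // => i _.
by rewrite f0 mulr0.
Qed.

Lemma frame_inj : injective p.
Proof.
move=> i j pij; have := bary_vertex i j.
by rewrite -pij bary_vertex eqxx; case: eqP => // _ /eqP; rewrite oner_eq0.
Qed.

Lemma slope_sum0 u : \sum_i slope p i u = 0.
Proof. by rewrite sumrB !bary_sum1 subrr. Qed.

Lemma slope_comb u : \sum_i slope p i u *: p i = u.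
Proof.
under eq_bigr do rewrite scalerBl.
by rewrite sumrB !bary_comb subr0.
Qed.

End Frame.

Lemma frameP p :
  (forall c : 'I_d.+1 -> R, \sum_i c i = 0 -> \sum_i c i *: p i = 0 ->
     forall i, c i = 0) -> frame p.
Proof.
move=> pI; rewrite /frame -row_free_unit -kermx_eq0; apply/eqP/row_matrixP => k.
rewrite row0; set c := row k _.
have : c *m frame_mx p = 0 by apply/sub_kermxP; exact: row_sub.
rewrite mulmx_sum_row => h.
apply/rowP => i; rewrite [RHS]mxE; apply: (pI (fun i => c ord0 i)).
  move/rowP: h => /(_ (lshift d ord0)); rewrite summxE [RHS]mxE; apply: etrans.
  by apply: eq_bigr => j _; rewrite rowK [RHS]mxE homog_l mulr1.
apply/rowP => l; move/rowP: h => /(_ (rshift 1 l)).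
rewrite !summxE [X in _ = X -> _]mxE [X in _ -> _ = X]mxE; apply: etrans.
by apply: eq_bigr => j _; rewrite rowK [LHS]mxE [RHS]mxE homog_r.
Qed.

Lemma frame_free p (c : 'I_d.+1 -> R) : frame p ->
  \sum_i c i = 0 -> \sum_i c i *: p i = 0 -> forall i, c i = 0.
Proof.
move=> pF c0 cp i.
have := bary_unique pF (c := fun j => bary p j 0 + c j) (x := 0) i.
rewrite big_split /= bary_sum1 // c0 addr0 => /(_ erefl).
under eq_bigr do rewrite scalerDl.
rewrite big_split /= bary_comb // cp addr0 => /(_ erefl) /eqP.
by rewrite eq_sym addrC -subr_eq0 addrK => /eqP.
Qed.

Definition replace p (v : 'I_d.+1) x : 'I_d.+1 -> point :=
  fun i => if i == v then x else p i.

Lemma frame_replace p v x : frame p -> bary p v x != 0 -> frame (replace p v x).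
Proof.
move=> pF lv; apply: frameP => c c0 cp.
have h (i : 'I_d.+1) : c v * bary p i x + (if i == v then 0 else c i) = 0.
  apply: (frame_free pF (c := fun i => c v * bary p i x +
             (if i == v then 0 else c i))) => {i}.
    rewrite big_split /= -mulr_sumr bary_sum1 // mulr1 (bigD1 v) //= eqxx add0r.
    rewrite -[RHS]c0 [RHS](bigD1 v) //=; congr (_ + _); apply: eq_bigr => i /negbTE -> //.
  under eq_bigr do rewrite scalerDl -scalerA.
  rewrite big_split /= -scaler_sumr bary_comb //.
  rewrite (bigD1 v) //= eqxx scale0r add0r -[RHS]cp.
  rewrite [RHS](bigD1 v) //= /replace eqxx; congr (_ + _).
  by apply: eq_bigr => i /negbTE ->.
have cv : c v = 0.
  by have /eqP := h v; rewrite eqxx addr0 mulf_eq0 (negbTE lv) orbF => /eqP.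
move=> i; have [->//|iv] := eqVneq i v.
by have := h i; rewrite (negbTE iv) cv mul0r add0r.
Qed.

End Barycentric.

Lemma sum_gt0_term (R : realDomainType) n (c f : 'I_n -> R) :
  (forall i, 0 <= f i) -> 0 < \sum_i c i * f i -> exists2 i, 0 < c i & 0 < f i.
Proof.
move=> f0; apply: contraPP => h; apply/negP; rewrite -leNgt; apply: sumr_le0.
move=> i _; have [ci|ci] := ltP 0 (c i); last exact: mulr_le0_ge0.
have := f0 i; rewrite le_eqVlt => /orP[/eqP <-|fi]; first by rewrite mulr0.
by case: h; exists i.
Qed.

Lemma sum_lt0_term (R : realDomainType) n (c f : 'I_n -> R) :
  (forall i, 0 <= f i) -> \sum_i c i * f i < 0 -> exists2 i, c i < 0 & 0 < f i.
Proof.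
move=> f0 s0; have := @sum_gt0_term R n (fun i => - c i) f f0.
under eq_bigr do rewrite mulNr.
by rewrite sumrN oppr_gt0 => /(_ s0)[i]; rewrite oppr_gt0; exists i.
Qed.

Lemma sum_eq0_terms (R : realDomainType) n (c f : 'I_n -> R) v :
  (forall i, 0 <= f i) -> \sum_i c i * f i = 0 -> c v * f v != 0 ->
  (exists2 i, 0 < c i & 0 < f i) /\ (exists2 i, c i < 0 & 0 < f i).
Proof.
move=> f0; rewrite (bigD1 v) //= => s0 cf.
pose f' i := if i == v then 0 else f i.
have f'0 i : 0 <= f' i by rewrite /f'; case: eqP.
have f'f i : 0 < f' i -> 0 < f i by rewrite /f'; case: eqP; rewrite ?ltxx.
have e : \sum_i c i * f' i = - (c v * f v).
  rewrite (bigD1 v) //= {1}/f' eqxx mulr0 add0r; apply/eqP.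
  rewrite -addr_eq0 addrC -[X in _ == X]s0.
  by apply/eqP; congr (_ + _); apply: eq_bigr => i /negbTE iv; rewrite /f' iv.
have fv : 0 < f v.
  by rewrite lt_def f0 andbT; apply: contraNneq cf => ->; rewrite mulr0.
have [cv|cv|cv] := ltgtP (c v) 0; last by rewrite cv mul0r eqxx in cf.
- split; last by exists v.
  have [|i ci fi] := @sum_gt0_term _ _ c f' f'0; last by exists i => //; apply: f'f.
  by rewrite e oppr_gt0 pmulr_llt0.
- split; first by exists v.
  have [|i ci fi] := @sum_lt0_term _ _ c f' f'0; last by exists i => //; apply: f'f.
  by rewrite e oppr_lt0 pmulr_lgt0.
Qed.

Lemma int_gt0_ge1 (R : archiRealDomainType) (x : R) : x \is a Num.int -> 0 < x -> 1 <= x.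
Proof. by move=> xZ x0; rewrite -(gtr0_norm x0) norm_intr_ge1 // gt_eqF. Qed.

(** * Exchanging one vertex of a lattice simplex *)

Section Exchange.
Variables (R : realType) (d k : nat).
Local Notation point := 'rV[R]_d.
Local Notation K := (k%:R : R).
Implicit Types (x y u : point) (p q : 'I_d.+1 -> point) (s : R).

Definition site x := x \is a mxOver Num.int /\ hypercube k x.

Definition placed p := frame p /\ forall i, site (p i).

(** Both sides of the affine dependence between x and the points of p have at
    least two elements: a, b on one side, x and c on the other.  This is convex
    position for these d+2 points. *)
Definition insertable p x := exists a b c,
  [/\ a != b, 0 < bary p a x, 0 < bary p b x & bary p c x < 0].

Inductive reach p : ('I_d.+1 -> point) -> Prop :=
| reach_refl : reach p p
| reach_step q v x of reach p q & site x & insertable q x & bary q v x != 0 :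
    reach p (replace q v x).

Lemma reach_trans p q r : reach p q -> reach q r -> reach p r.
Proof. by move=> pq qr; elim: qr => // *; apply: reach_step. Qed.

Lemma reach1 p v x :
  site x -> insertable p x -> bary p v x != 0 -> reach p (replace p v x).
Proof. by apply: reach_step; exact: reach_refl. Qed.

Lemma placed_replace p v x :
  placed p -> site x -> bary p v x != 0 -> placed (replace p v x).
Proof.
move=> [pF pS] xS lv; split; first exact: frame_replace.
by move=> i; rewrite /replace; case: eqP.
Qed.

Lemma reach_placed p q : placed p -> reach p q -> placed q.
Proof. by move=> pP; elim=> // r v x _ rP xS _ lv; apply: placed_replace. Qed.

Definition unit_vec (i : 'I_d) : point := delta_mx ord0 i.

Lemma unit_vecE i j : unit_vec i ord0 j = (j == i)%:R.
Proof. by rewrite mxE. Qed.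

Lemma site_shift x s i : site x -> s = 1 \/ s = -1 ->
  0 <= x ord0 i + s <= K -> site (x + s *: unit_vec i).
Proof.
move=> [xZ xC] hs hx; split.
  apply/mxOverP => a j; rewrite ord1 !mxE eqxx /= rpredD //; first exact: (mxOverP xZ).
  by apply: rpredM; [case: hs => ->; rewrite ?rpredN ?rpred1|exact: natr_int].
move=> j; rewrite !mxE eqxx /=; have [->|_] := eqVneq j i; first by rewrite mulr1.
by rewrite mulr0 addr0.
Qed.

Lemma height_sum p x (h : 'I_d) (a b : R) : frame p ->
  \sum_i bary p i x * (a * (p i ord0 h) + b) = a * x ord0 h + b.
Proof.
move=> pF; rewrite -(affine_fun_bary_comb pF (f := fun y => a * y ord0 h + b)) //.
apply: affine_funD; last exact: affine_fun_cst.
exact/affine_funZ/affine_fun_coord.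
Qed.

Lemma bary_shift p i (w : 'I_d.+1) s u : frame p ->
  bary p i (p w + s *: u) = (i == w)%:R + s * slope p i u.
Proof. by move=> pF; rewrite bary_add bary_vertex // slopeZ. Qed.

Lemma slope_height p i (h : 'I_d) :
  (forall j, j != h -> slope p i (unit_vec j) = 0) ->
  forall x y, bary p i x - bary p i y = (x ord0 h - y ord0 h) * slope p i (unit_vec h).
Proof.
move=> s0 x y; rewrite -{1}[x](subrK y) [_ + y]addrC bary_add.
set u := x - y; have -> : u = \sum_j u ord0 j *: unit_vec j.
  by rewrite {1}[u]row_sum_delta.
have -> : slope p i (\sum_j u ord0 j *: unit_vec j)
   = \sum_j u ord0 j * slope p i (unit_vec j).
  elim/big_ind2: _ => [|a b c e <- <-|j _]; [exact: slope0|exact: slopeD|exact: slopeZ].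
rewrite (bigD1 h) //= big1 => [|j jh]; last by rewrite s0 // mulr0.
by rewrite /u !mxE; ring.
Qed.

(** Otherwise coordinate v1 would be an affine function of the height alone;
    vanishing at two distinct heights, it would also vanish at p v1. *)
Lemma exists_slope_neq0 p v1 v2 v3 (h : 'I_d) : frame p ->
  v2 != v1 -> v3 != v1 -> p v2 ord0 h != p v3 ord0 h ->
  exists2 i, i != h & slope p v1 (unit_vec i) != 0.
Proof.
move=> pF v21 v31 h23; apply: contrapT => N.
have s0 j : j != h -> slope p v1 (unit_vec j) = 0.
  by move=> jh; apply/eqP; apply: contrapT => /negP sj; apply: N; exists j.
have e := slope_height s0.
have := e (p v2) (p v3); rewrite !bary_vertex // eq_sym (negbTE v21).
rewrite eq_sym (negbTE v31) subrr => /esym/eqP; rewrite mulf_eq0 subr_eq0 (negbTE h23) /=.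
move=> /eqP sh0; have := e (p v1) (p v2); rewrite sh0 mulr0 !bary_vertex // eqxx.
by rewrite eq_sym (negbTE v21) subr0 => /eqP; rewrite oner_eq0.
Qed.

End Exchange.

(** * Moving the vertices into two slices *)

Section TwoSlices.
Variables (R : realType) (d k : nat).
Hypothesis k_gt0 : (0 < k)%N.
Local Notation point := 'rV[R]_d.
Local Notation K := (k%:R : R).
Implicit Types (x y u : point) (p q : 'I_d.+1 -> point) (s : R).

Definition dist1 x y : R := \sum_i `|x ord0 i - y ord0 i|.

Definition strictly_between (a b c : R) : bool := (a < b) && (b < c).

(** Consider the distances to the slice of x and to the opposite slice.  The former
    vanishes at x although the term of v is nonzero, so it has a positive and a
    negative term in barycentric coordinates; the latter is positive at x, so it has
    a positive term.  When x has only one positive coordinate, both positive terms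
    come from the same vertex, which is therefore in neither slice. *)
Lemma slice_not_insertable p (h : 'I_d) (m M : R) v x : frame p -> m < M ->
  (forall i, m <= p i ord0 h <= M) ->
  x ord0 h = M \/ x ord0 h = m ->
  bary p v x != 0 -> strictly_between m (p v ord0 h) M -> ~ insertable p x ->
  exists2 j, strictly_between m (p j ord0 h) M & forall l, l != j -> bary p l x <= 0.
Proof.
move=> pF mM hp hx lv /andP[v1 v2] xI.
pose e : R := if x ord0 h == M then 1 else -1.
pose z := if x ord0 h == M then m else M.
have xh0 : x ord0 h = if x ord0 h == M then M else m.
  by case: hx => ->; [rewrite eqxx|rewrite lt_eqF].
pose f i := (- e) * p i ord0 h + e * x ord0 h.
pose g i := e * p i ord0 h + (- (e * z)).
have f0 i : 0 <= f i.
  have /andP[] := hp i; rewrite /f /e; case: eqP xh0 => _ ->; lra.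
have g0 i : 0 <= g i.
  have /andP[] := hp i; rewrite /g /e /z; case: eqP; lra.
have [||[a la fa] [c lc _]] := @sum_eq0_terms _ _ (fun i => bary p i x) f v f0.
- by rewrite height_sum //; ring.
- rewrite mulf_neq0 //; rewrite gt_eqF // /f /e; case: eqP xh0 => _ ->; lra.
have [|a' la' ga'] := @sum_gt0_term _ _ (fun i => bary p i x) g g0.
  by rewrite height_sum // /e /z; case: eqP xh0 => _ ->; lra.
have one l : l != a -> bary p l x <= 0.
  move=> la0; rewrite leNgt; apply/negP => lp; apply: xI; exists l, a, c; by split.
have e' : a' = a by apply: contraTeq la' => /one; rewrite -leNgt.
exists a => //; rewrite e' in ga'; have /andP[] := hp a.
move: fa ga'; rewrite /strictly_between /f /g /e /z; case: eqP xh0 => _ ->; lra.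
Qed.

(** If no vertex strictly between the extremal slices could be exchanged for a point
    of these slices, then shifting an extremal vertex by a unit vector e_i would never
    be an insertion.  This forces all the extremal vertices onto one wall of the cube
    orthogonal to e_i, and then some vertex that is off the wall, hence strictly
    between the slices, can be brought one step closer to it. *)
Lemma two_slices_step p (h : 'I_d) t b v : placed k p ->
  (forall i, p b ord0 h <= p i ord0 h <= p t ord0 h) ->
  strictly_between (p b ord0 h) (p v ord0 h) (p t ord0 h) ->
  exists w x, [/\ site k x, insertable p x, bary p w x != 0,
    strictly_between (p b ord0 h) (p w ord0 h) (p t ord0 h) &
    [\/ x ord0 h = p t ord0 h, x ord0 h = p b ord0 h |
        x ord0 h = p w ord0 h /\ dist1 x (p t) <= dist1 (p w) (p t) - 1]].
Proof.
move=> [pF pS] hp hv; apply: contrapT => N.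
set m := p b ord0 h in hp hv N *; set M := p t ord0 h in hp hv N *.
have mM : m < M by case/andP: hv; exact: lt_trans.
have K1 : 1 <= K by rewrite ler1n.
have tv : t != v by apply: contraTneq hv => <-; rewrite /strictly_between ltxx andbF.
have bv : b != v by apply: contraTneq hv => <-; rewrite /strictly_between ltxx.
have [|i ih sv0] := exists_slope_neq0 (h := h) pF tv bv; first by rewrite gt_eqF.
pose ei : point := unit_vec R i; pose sl l := slope p l ei.
have eh s : (s *: ei) ord0 h = 0.
  by rewrite !mxE eqxx /= eq_sym (negbTE ih) mulr0.
(* When the shift of an extremal vertex w fails, w is not the only vertex j with a
   positive coordinate, so its own coordinate 1 + s * sl w is at most 0. *)
have fail w s : s = 1 \/ s = -1 -> p w ord0 h = M \/ p w ord0 h = m ->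
    0 <= p w ord0 i + s <= K ->
    s * sl w <= -1 /\ exists2 j, strictly_between m (p j ord0 h) M &
                        forall l, l != j -> s * sl l <= 0.
  move=> hs hw wi; have xS := site_shift (pS w) hs wi.
  have xh : (p w + s *: ei) ord0 h = p w ord0 h by rewrite mxE eh addr0.
  have wv : (v == w) = false.
    apply/negP => /eqP vw; move: hv; rewrite vw /strictly_between.
    by case: hw => ->; rewrite ltxx ?andbF.
  have lv : bary p v (p w + s *: ei) != 0.
    rewrite bary_shift // wv add0r mulf_neq0 //.
    by case: hs => ->; rewrite ?oppr_eq0 oner_eq0.
  have xI : ~ insertable p (p w + s *: ei).
    move=> xI; apply: N; exists v, (p w + s *: ei); split=> //.
    by rewrite xh; case: hw => ->; [apply: Or31|apply: Or32].
  have [|j jm hj] := slice_not_insertable (h := h) pF mM hp _ lv hv xI; first by rewrite xh.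
  have wj : w != j.
    apply: contraTneq jm => <-; rewrite /strictly_between.
    by case: hw => ->; rewrite ltxx ?andbF.
  have sw : s * sl w <= -1.
    by have := hj w wj; rewrite bary_shift // eqxx /=; rewrite /sl; lra.
  split=> //; exists j => // l lj; have [->|lw] := eqVneq l w; first lra.
  by have := hj l lj; rewrite bary_shift // (negbTE lw) add0r.
have bnd l : 0 <= p l ord0 i <= K by case: (pS l) => _; apply.
have pZ l : p l ord0 i \is a Num.int by case: (pS l) => /mxOverP.
have KZ : K \is a Num.int by exact: natr_int.
(* as k is positive, at least one of the two shifts of t stays in the cube *)
pose s : R := if p t ord0 i == 0 then 1 else -1.
have hs : s = 1 \/ s = -1 by rewrite /s; case: eqP; [left|right].
have hNs : - s = 1 \/ - s = -1 by case: hs => ->; rewrite ?opprK; [right|left].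
have ts : 0 <= p t ord0 i + s <= K.
  have /andP[t1 t2] := bnd t; rewrite /s; case: eqP => [->|/eqP t0]; first lra.
  have := int_gt0_ge1 (pZ t); rewrite lt_def t0 t1 => /(_ erefl); lra.
have [slt [j jm hj]] := fail t s hs (or_introl erefl) ts.
have tj : t != j by apply: contraTneq jm => <-; rewrite /strictly_between ltxx andbF.
have bj : b != j by apply: contraTneq jm => <-; rewrite /strictly_between ltxx.
(* no extremal vertex can be shifted backwards, as it would get a slope of the
   sign that only j has *)
have stuck w : p w ord0 h = M \/ p w ord0 h = m -> ~ (0 <= p w ord0 i - s <= K).
  move=> hw wi; have [sw _] := fail w (- s) hNs hw wi.
  have wj : w != j.
    apply: contraTneq jm => <-; rewrite /strictly_between.
    by case: hw => ->; rewrite ltxx ?andbF.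
  by have := hj w wj; lra.
(* c is the wall that t is to leave, and y measures the distance to it *)
pose c : R := if s == 1 then 0 else K.
pose y l := s * (p l ord0 i - c).
have yE l : s = 1 /\ y l = p l ord0 i \/ s = -1 /\ y l = K - p l ord0 i.
  rewrite /y /c; case: hs => ->; [left|right]; split=> //.
    by rewrite eqxx subr0 mul1r.
  have -> : ((-1 : R) == 1) = false by apply/eqP; lra.
  by ring.
have y0 l : 0 <= y l by have := bnd l; case: (yE l) => -[_ ->]; lra.
have yZ l : y l \is a Num.int.
  by case: (yE l) => -[_ ->] //; apply: rpredB.
have step_back l : 1 <= y l -> 0 <= p l ord0 i - s <= K.
  by have := bnd l; case: (yE l) => -[-> ->]; lra.
have y_ext w : p w ord0 h = M \/ p w ord0 h = m -> y w = 0.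
  move=> hw; apply: contrapT => /eqP yw; apply: (stuck w hw); apply: step_back.
  by apply: int_gt0_ge1 => //; rewrite lt_def yw y0.
have yt : y t = 0 by apply: y_ext; left.
have yb : y b = 0 by apply: y_ext; right.
have ss : s * s = 1 by case: hs => ->; ring.
have s_neq0 : s != 0 by case: hs => ->; rewrite ?oppr_eq0 oner_neq0.
have bs : 0 <= p b ord0 i + s <= K.
  have pbt : p b ord0 i = p t ord0 i.
    by move: yb; rewrite -yt /y => /(mulfI s_neq0)/addIr.
  by rewrite pbt.
have [slb _] := fail b s hs (or_intror erefl) bs.
have slj : 2 <= s * sl j.
  have tb : b != t by apply: contraTneq mM => bt; rewrite /m /M bt ltxx.
  have : \sum_l s * sl l = 0 by rewrite -mulr_sumr slope_sum0 // mulr0.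
  rewrite (bigD1 j) //= (bigD1 t) //= (bigD1 b) /=; last by rewrite bj tb.
  set r := \sum_(_ | _) _ => e; have r0 : r <= 0.
    by apply: sumr_le0 => l /andP[/andP[lj _] _]; exact: hj.
  lra.
(* the i-th coordinate of the relation expressing e_i by the slopes *)
have sy : \sum_l s * sl l * y l = 1.
  have -> : \sum_l s * sl l * y l = \sum_l sl l * p l ord0 i - c * \sum_l sl l.
    rewrite mulr_sumr -sumrB; apply: eq_bigr => l _; rewrite /y.
    move: (sl l) (p l ord0 i) => a1 a2.
    have -> : s * a1 * (s * (a2 - c)) = (s * s) * (a1 * (a2 - c)) by ring.
    by rewrite ss; ring.
  rewrite slope_sum0 // mulr0 subr0.
  have /rowP/(_ i) := slope_comb pF ei; rewrite summxE [RHS]unit_vecE eqxx => e.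
  by rewrite -[RHS]e; apply: eq_bigr => l _; rewrite mxE.
(* the integer y j is 0 or makes its own term at least 2 *)
have [l lj sly] : exists2 l, l != j & s * sl l * y l < 0.
  apply: contrapT => Nl.
  have pos l : l != j -> s * sl l * y l = 0.
    move=> lj; apply/eqP; rewrite eq_le mulr_le0_ge0 ?hj //= leNgt.
    by apply/negP => ?; apply: Nl; exists l.
  move: sy; rewrite (bigD1 j) //= big1 // addr0 => sy.
  have slj0 : 0 < s * sl j by lra.
  have yj : 0 < y j by rewrite -(pmulr_rgt0 _ slj0) sy.
  have := int_gt0_ge1 (yZ j) yj => yj1.
  have : 2 * 1 <= s * sl j * y j by rewrite ler_pM.
  rewrite sy; lra.
have yl : 0 < y l by rewrite lt_def y0 andbT; apply: contraTneq sly => ->; rewrite mulr0 ltxx.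
have sll : s * sl l < 0 by rewrite -(pmulr_llt0 _ yl).
have yl1 := int_gt0_ge1 (yZ l) yl.
have l_mid : strictly_between m (p l ord0 h) M.
  have /andP[l1 l2] := hp l.
  rewrite /strictly_between !lt_def l1 l2 !andbT; apply/andP; split.
    by apply/eqP => e; move: yl; rewrite y_ext ?ltxx //; right.
  by apply/eqP => e; move: yl; rewrite y_ext ?ltxx //; left.
have tl : t != l by apply: contraTneq yl => <-; rewrite yt ltxx.
have xE n : bary p n (p l + (- s) *: ei) = (n == l)%:R - s * sl n.
  by rewrite bary_shift // mulNr.
apply: N; exists l, (p l + (- s) *: ei); split => //.
- by apply: site_shift => //; apply: step_back.
- exists l, t, j; split; rewrite ?xE ?eqxx /=; first by rewrite eq_sym.
  + by lra.
  + by rewrite (negbTE tl) /=; lra.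
  + by rewrite eq_sym (negbTE lj) /=; lra.
- by rewrite xE eqxx /= gt_eqF //; lra.
- apply: Or33; split; first by rewrite mxE eh addr0.
  rewrite /dist1 [X in X <= _](bigD1 i) //= [X in _ <= X - _](bigD1 i) //=.
  rewrite (eq_bigr (fun n => `|p l ord0 n - p t ord0 n|)); last first.
    by move=> n ni; rewrite !mxE eqxx /= (negbTE ni) mulr0 addr0.
  have ptc : p t ord0 i = c
    by apply/eqP; rewrite -subr_eq0 -(mulrI_eq0 _ (mulfI s_neq0)) -/(y t) yt.
  have ny z : `|s * z| = `|z| by rewrite normrM; case: hs => ->; rewrite ?normrN normr1 mul1r.
  rewrite ptc -[`|p l ord0 i - c|]ny -/(y l) -[X in X + _ <= _]ny.
  have -> : s * ((p l + - s *: ei) ord0 i - c) = y l - 1.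
    by rewrite !mxE !eqxx /= /y -[X in _ = _ - X]ss; ring.
  rewrite ger0_norm ?ger0_norm //; last lra.
  lra.
Qed.

End TwoSlices.

(** * Moving the vertices to corners of the cube *)

Section Corners.
Variables (R : realType) (d k : nat).
Hypothesis k_gt0 : (0 < k)%N.
Local Notation point := 'rV[R]_d.
Local Notation K := (k%:R : R).
Implicit Types (x y z u : point) (p q : 'I_d.+1 -> point) (s m M : R).

Lemma frame_height p (h : 'I_d) (a : R) : frame p -> exists i, p i ord0 h != a.
Proof.
move=> pF; apply: contrapT => N.
have e i : p i ord0 h - a = 0.
  apply/eqP; rewrite subr_eq0; apply/negPn/negP => pi; apply: N; by exists i.
have := affine_fun_eq0 pF (affine_funB (affine_fun_coord h) (@affine_fun_cst R d a)) e.
move=> /(_ (const_mx (a + 1))) /eqP; rewrite mxE addrAC subrr add0r.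
by rewrite oner_eq0.
Qed.

Lemma replace_eq p v x : replace p v x v = x.
Proof. by rewrite /replace eqxx. Qed.

Lemma replace_neq p v x i : i != v -> replace p v x i = p i.
Proof. by rewrite /replace => /negbTE ->. Qed.

Lemma dist1_ge0 x y : 0 <= dist1 x y.
Proof. by apply: sumr_ge0 => i _. Qed.

Lemma reach_two_slices p (h : 'I_d) : placed k p -> exists q b t,
  [/\ reach k p q, q b ord0 h < q t ord0 h &
      forall i, q i ord0 h = q b ord0 h \/ q i ord0 h = q t ord0 h].
Proof.
move=> pP.
have [b _ hb] := @arg_minP _ _ _ ord0 predT (fun i => p i ord0 h) isT.
have [t _ ht] := @arg_maxP _ _ _ ord0 predT (fun i => p i ord0 h) isT.
have hp i : p b ord0 h <= p i ord0 h <= p t ord0 h by apply/andP; split; [exact: hb|exact: ht].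
have bt : p b ord0 h < p t ord0 h.
  rewrite ltNge; apply/negP => tb.
  have [i] := frame_height h (p b ord0 h) (proj1 pP).
  rewrite eq_le => /negP; apply; apply/andP; split; last exact: hb.
  exact: le_trans (ht i isT) tb.
pose m := p b ord0 h; pose M := p t ord0 h; pose T := p t.
(* at least 1 on vertices strictly between the slices; the distance to t makes it
   decrease also when such a vertex stays between them *)
pose weight x := if strictly_between m (x ord0 h) M then 1 + dist1 x T else 0.
pose measure q := \sum_i weight (q i).
have weight0 x : 0 <= weight x.
  by rewrite /weight; case: ifP => // _; rewrite addr_ge0 // dist1_ge0.
suff main n q : placed k q -> q b = p b -> q t = p t ->
    (forall i, m <= q i ord0 h <= M) -> measure q < n%:R ->
    exists r, [/\ reach k q r, r b = p b, r t = p t &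
      forall i, r i ord0 h = m \/ r i ord0 h = M].
  have [r [pr rb rt hr]] := main _ p pP erefl erefl hp (truncnS_gt (measure p)).
  by exists r, b, t; split=> //; rewrite ?rb ?rt.
elim: n q => [|n IHn] q qP qb qt hq hn.
  by move: hn; rewrite ltNge sumr_ge0.
have [[v hv]|N] := pselect (exists v, strictly_between m (q v ord0 h) M); last first.
  exists q; split=> //; first exact: reach_refl.
  move=> i; have := hq i; rewrite le_eqVlt => /andP[/orP[/eqP->|im]]; first by left.
  rewrite le_eqVlt => /orP[/eqP->|iM]; first by right.
  by case: N; exists i; rewrite /strictly_between im.
have [||w [x [xS xI lw wm wx]]] := @two_slices_step R d k k_gt0 q h t b v qP;
  rewrite ?qb ?qt //.
rewrite qb qt -/m -/M -/T in wm wx.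
have wb : b != w by apply: contraTneq wm => <-; rewrite qb /strictly_between ltxx.
have wt : t != w by apply: contraTneq wm => <-; rewrite qt /strictly_between ltxx andbF.
have hm : weight x <= weight (q w) - 1.
  rewrite /weight wm; have := dist1_ge0 (q w) T.
  case: wx => [->|->|[-> dx]] dw; rewrite ?wm /strictly_between ?ltxx ?andbF /=; lra.
have [|||||r [qr rb rt hr]] := IHn (replace q w x).
- exact: placed_replace.
- by rewrite replace_neq.
- by rewrite replace_neq.
- move=> i; have [->|iw] := eqVneq i w; last by rewrite replace_neq.
  rewrite replace_eq; case: wx => [->|->|[-> _]] //; by rewrite ?lexx ?(ltW bt).
- have -> : measure (replace q w x) = measure q - weight (q w) + weight x.
    rewrite /measure (bigD1 w) //= replace_eq [in RHS](bigD1 w) //=.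
    rewrite (eq_bigr (fun i => weight (q i))); last by move=> i iw; rewrite replace_neq.
    by ring.
  by move: hn; rewrite -natr1; lra.
by exists r; split=> //; apply: reach_trans qr; exact: reach1.
Qed.

Definition corner x := forall j, x ord0 j = 0 \/ x ord0 j = K.

Definition slice_corner (h : 'I_d) M x :=
  x ord0 h = M /\ forall j, j != h -> x ord0 j = 0 \/ x ord0 j = K.

Lemma slice_corner_site h M x : M \is a Num.int -> 0 <= M <= K ->
  slice_corner h M x -> site k x.
Proof.
move=> MZ hM [xh xj]; split.
  apply/mxOverP => a j; rewrite ord1; have [->|jh] := eqVneq j h; first by rewrite xh.
  by case: (xj j jh) => ->; rewrite ?rpred0 ?natr_int.
move=> j; have [->|jh] := eqVneq j h; first by rewrite xh.
by case: (xj j jh) => ->; rewrite lexx ler0n.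
Qed.

(** While two vertices v and b lie outside the slice at height M, the coordinate
    of v is not constant on that slice, so it is nonzero at some corner of the
    slice; this corner can replace v. *)
Lemma reach_pyramid p (h : 'I_d) b m M : placed k p -> m != M ->
  M \is a Num.int -> 0 <= M <= K ->
  p b ord0 h = m -> (forall i, p i ord0 h = m \/ p i ord0 h = M) ->
  exists q, [/\ reach k p q, q b = p b & forall i, i != b ->
    q i ord0 h = M /\ (p i ord0 h = M /\ q i = p i \/ slice_corner h M (q i))].
Proof.
move=> pP mM MZ hM.
move: {2}#|_| (leqnn #|[pred i | (i != b) && (p i ord0 h != M)]|) => n.
elim: n p pP => [|n IHn] p pP hn pb hp.
  exists p; split=> //; first exact: reach_refl.
  move=> i ib; have hi : p i ord0 h = M.
    apply/eqP/negPn/negP => pi; move: hn; rewrite leqn0 => /eqP/card0_eq/(_ i).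
    by rewrite !inE ib pi.
  by split=> //; left.
have [v hv|N] := pickP (fun i => (i != b) && (p i ord0 h != M)); last first.
  by apply: IHn => //; rewrite eq_card0 // => i; rewrite inE N.
have [pF pS] := pP.
have /andP[vb /negPf vM] := hv.
have vm : p v ord0 h = m by case: (hp v) => // /eqP; rewrite vM.
have [t ht] := frame_height h m pF.
have tM : p t ord0 h = M by case: (hp t) => // /eqP; rewrite (negbTE ht).
have bv : b != v by rewrite eq_sym.
have tv : t != v by apply: contraFneq vM => <-; rewrite tM.
have [|i ih si] := exists_slope_neq0 (h := h) pF bv tv; first by rewrite pb tM.
pose x0 : point := M *: unit_vec R h; pose x1 := x0 + K *: unit_vec R i.
have x0c : slice_corner h M x0.
  split=> [|j jh]; rewrite !mxE eqxx /= ?eqxx ?mulr1 // (negbTE jh) mulr0; by left.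
have x1c : slice_corner h M x1.
  split=> [|j jh]; rewrite !mxE eqxx /=.
    by rewrite eqxx eq_sym (negbTE ih) mulr1 mulr0 addr0.
  by rewrite (negbTE jh) mulr0 add0r; case: eqP => _; rewrite ?mulr0 ?mulr1; [right|left].
have [x xc lx] : exists2 x, slice_corner h M x & bary p v x != 0.
  have [e|?] := eqVneq (bary p v x0) 0; last by exists x0.
  exists x1 => //; rewrite bary_add e add0r slopeZ mulf_neq0 //.
  by rewrite pnatr_eq0 -lt0n.
have xS := slice_corner_site MZ hM xc.
have xI : insertable p x.
  pose c := (m - M)^-1; have mM0 : m - M != 0 by rewrite subr_eq0.
  have Fm : c * m + - (c * M) = 1 by rewrite -mulrBr mulVf.
  have FM : c * M + - (c * M) = 0 by rewrite subrr.
  pose f i := c * p i ord0 h + - (c * M).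
  have f01 i0 : f i0 = 0 \/ f i0 = 1 by rewrite /f; case: (hp i0) => ->; [right|left].
  have f0 i0 : 0 <= f i0 by case: (f01 i0) => ->; rewrite ?ler01.
  have sf : \sum_i bary p i x * f i = 0 by rewrite height_sum // (proj1 xc).
  have [|[a la fa] [e le _]] := @sum_eq0_terms _ _ (fun i => bary p i x) f v f0 sf.
    by rewrite mulf_neq0 // /f vm Fm oner_neq0.
  have g0 i0 : 0 <= 1 - f i0 by case: (f01 i0) => ->; rewrite ?subrr ?subr0 ?ler01.
  have [|a' la' ga'] := @sum_gt0_term _ _ (fun i => bary p i x) _ g0.
    under eq_bigr do rewrite mulrBr mulr1.
    by rewrite sumrB sf bary_sum1 // subr0 ltr01.
  exists a, a', e; split=> //; apply: contraTneq ga' => <-.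
  by move: fa; case: (f01 a) => ->; rewrite ?ltxx // subrr ltxx.
have [||||q [pq qb hq]] := IHn (replace p v x).
- exact: placed_replace.
- rewrite -ltnS; apply: leq_trans hn; apply: proper_card; apply/properP; split.
    apply/fintype.subsetP => j; rewrite !inE => /andP[-> /=].
    have [->|jv] := eqVneq j v; last by rewrite replace_neq.
    by rewrite replace_eq (proj1 xc) eqxx.
  by exists v; rewrite !inE ?hv // replace_eq (proj1 xc) eqxx andbF.
- by rewrite replace_neq.
- move=> j; have [->|jv] := eqVneq j v; last by rewrite replace_neq.
  by rewrite replace_eq (proj1 xc); right.
exists q; split; first by apply: reach_trans pq; exact: reach1.
  by rewrite qb replace_neq.
move=> j jb; have [qM hj] := hq j jb; split=> //.
case: hj => [[rM rj]|]; last by right.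
have [jv|jv] := eqVneq j v; last by left; rewrite replace_neq in rM rj.
by right; rewrite rj jv replace_eq.
Qed.

Lemma bary_apex p (h : 'I_d) b M x : frame p -> p b ord0 h != M ->
  (forall i, i != b -> p i ord0 h = M) ->
  bary p b x = (x ord0 h - M) / (p b ord0 h - M).
Proof.
move=> pF pb hp; have := height_sum x h 1 (- M) pF; rewrite (bigD1 b) //= big1.
  by rewrite addr0 !mul1r => <-; rewrite mulfK // subr_eq0.
by move=> i ib; rewrite hp // mul1r subrr mulr0.
Qed.

Lemma bary_sum_others p b x : frame p ->
  \sum_i bary p i x * (i != b)%:R = 1 - bary p b x.
Proof.
move=> pF; rewrite -[X in _ = X - _](bary_sum1 pF x) [in RHS](bigD1 b) //= addrAC subrr add0r.
rewrite [RHS]big_mkcond; apply: eq_bigr => i _.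
by case: eqP => _; rewrite ?mulr1 ?mulr0.
Qed.

(** The coordinate of the apex at x is 1, so those of the base add up to 0; they are
    not all 0, since x is not the apex. *)
Lemma apex_level_insertable p (h : 'I_d) b M x : frame p -> p b ord0 h != M ->
  (forall i, i != b -> p i ord0 h = M) ->
  x ord0 h = p b ord0 h -> x != p b -> insertable p x.
Proof.
move=> pF pb hp xh xb; have pb0 : p b ord0 h - M != 0 by rewrite subr_eq0.
have lb : bary p b x = 1 by rewrite (bary_apex _ pF pb hp) xh divff.
have [v vb lv] : exists2 v, v != b & bary p v x != 0.
  apply: contrapT => N; case/eqP: xb; rewrite -[LHS](bary_comb pF) (bigD1 b) //=.
  rewrite lb scale1r big1 ?addr0 // => i ib.
  have [->|li] := eqVneq (bary p i x) 0; first by rewrite scale0r.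
  by case: N; exists i.
have [||[a la fa] [c lc _]] := @sum_eq0_terms _ _ (fun i => bary p i x)
    (fun i => (i != b)%:R : R) v (fun i => ler0n _ _).
- by rewrite bary_sum_others // lb subrr.
- by rewrite vb mulr1.
exists a, b, c; split=> //; last by rewrite lb ltr01.
by apply: contraTneq fa => ->; rewrite eqxx ltxx.
Qed.

(** The old apex would be absorbed only if x were beyond it, in the cone opposite to
    the base; the coordinate g prevents that, as it vanishes at the apex and is
    nonnegative on the base but positive at x. *)
Lemma apex_push_insertable p (h g : 'I_d) b M x : frame p ->
  (forall i, site k (p i)) -> p b ord0 h != M ->
  (forall i, i != b -> p i ord0 h = M) ->
  1 < (x ord0 h - M) / (p b ord0 h - M) -> p b ord0 g = 0 -> 0 < x ord0 g ->
  insertable p x.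
Proof.
move=> pF pS pb hp; rewrite -(bary_apex _ pF pb hp) => lb pg xg.
have [|c lc _] := @sum_lt0_term _ _ (fun i => bary p i x)
    (fun i => (i != b)%:R : R) (fun i => ler0n _ _).
  by rewrite bary_sum_others // subr_lt0.
have [||a la pa] := @sum_gt0_term _ _ (fun i => bary p i x) (fun i => p i ord0 g).
- by move=> i; have [_ /(_ g)/andP[]] := pS i.
- have := height_sum x g 1 0 pF; rewrite mul1r addr0 => e.
  rewrite (eq_bigr (fun i => bary p i x * (1 * p i ord0 g + 0))) ?e // => i _.
  by rewrite mul1r addr0.
exists a, b, c; split=> //; last exact: lt_trans lb.
by apply: contraTneq pa => ->; rewrite pg ltxx.
Qed.

(** The apex first moves to the edge of its slice where all the other coordinates
    vanish, so that the corner with coordinate g equal to k can then be inserted. *)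
Lemma reach_apex p (h g : 'I_d) b M n : g != h -> placed k p ->
  (forall i, i != b -> p i ord0 h = M) ->
  p b ord0 h < M /\ n = 0 \/ M < p b ord0 h /\ n = K ->
  exists q, [/\ reach k p q, corner (q b), q b ord0 h = n & forall i, i != b -> q i = p i].
Proof.
move=> gh pP hp hn.
have K0 : 0 < K by rewrite ltr0n.
have pb : p b ord0 h != M by case: hn => -[hb _]; [rewrite lt_eqF|rewrite gt_eqF].
have [pF pS] := pP.
have [pbZ /(_ h) pbC] := pS b.
have pbZh : p b ord0 h \is a Num.int by move/mxOverP: pbZ.
pose z : point := n *: unit_vec R h + K *: unit_vec R g.
have zh : z ord0 h = n.
  by rewrite !mxE !eqxx /= eq_sym (negbTE gh) mulr1 mulr0 addr0.
have zg : z ord0 g = K by rewrite !mxE !eqxx /= (negbTE gh) mulr1 mulr0 add0r.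
have zc : corner z.
  move=> j; have [->|jh] := eqVneq j h; first by rewrite zh; case: hn => -[_ ->]; [left|right].
  have [->|jg] := eqVneq j g; first by right.
  by left; rewrite !mxE !eqxx /= (negbTE jh) (negbTE jg) !mulr0 addr0.
have zS : site k z.
  apply: (@slice_corner_site h n); last by split.
    by case: hn => -[_ ->]; rewrite ?rpred0 ?natr_int.
  by case: hn => -[_ ->]; rewrite lexx ler0n.
have level x : site k x -> x ord0 h = p b ord0 h ->
    exists q, [/\ reach k p q, q b = x & forall i, i != b -> q i = p i].
  move=> xS xh; have [->|xb] := eqVneq x (p b).
    by exists p; split=> //; exact: reach_refl.
  exists (replace p b x); split; last by move=> i; apply: replace_neq.
    apply: reach1 => //; first exact: (apex_level_insertable pF pb hp xh xb).
    by rewrite (bary_apex _ pF pb hp) xh divff ?oner_neq0 // subr_eq0.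
  exact: replace_eq.
have [pbn|pbn] := eqVneq (p b ord0 h) n.
  have [|q [pq qb hq]] := level z zS; first by rewrite zh.
  by exists q; rewrite qb.
have [||q [pq qb hq]] := level (p b ord0 h *: unit_vec R h).
- apply: (slice_corner_site (h := h) pbZh pbC); split=> [|j jh]; rewrite !mxE !eqxx /=.
    by rewrite mulr1.
  by left; rewrite (negbTE jh) mulr0.
- by rewrite !mxE !eqxx mulr1.
have qP := reach_placed pP pq; have [qF qS] := qP.
have hqM i : i != b -> q i ord0 h = M by move=> ib; rewrite hq // hp.
have qbh : q b ord0 h = p b ord0 h by rewrite qb !mxE !eqxx mulr1.
have qbM : q b ord0 h != M by rewrite qbh.
have ratio : 1 < (z ord0 h - M) / (q b ord0 h - M).
  move: pbn pbC; rewrite zh qbh => pbn /andP[p0 pK]; case: hn => -[hb e]; rewrite e in pbn *.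
    rewrite ltr_ndivlMr ?subr_lt0 // mul1r ltrD2r.
    by rewrite lt_def pbn.
  rewrite ltr_pdivlMr ?subr_gt0 // mul1r ltrD2r.
  by rewrite lt_neqAle pbn.
exists (replace q b z); split.
- apply: (reach_trans pq); apply: reach1 => //.
    apply: (apex_push_insertable (g := g) qF qS qbM hqM ratio); last by rewrite zg.
    by rewrite qb !mxE !eqxx (negbTE gh) mulr0.
  by rewrite (bary_apex _ qF qbM hqM) gt_eqF // (lt_trans ltr01).
- by rewrite replace_eq.
- by rewrite replace_eq.
- by move=> i ib; rewrite replace_neq // hq.
Qed.

Lemma reach_corners p : (1 < d)%N -> placed k p ->
  exists2 q, reach k p q & forall i, corner (q i).
Proof.
move=> d1 pP; pose h : 'I_d := Ordinal (ltnW d1); pose g : 'I_d := Ordinal d1.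
have gh : g != h by [].
have K0 : 0 < K by rewrite ltr0n.
have [q0 [b [t [pq0 bt hq0]]]] := reach_two_slices h pP.
have q0P := reach_placed pP pq0.
set m := q0 b ord0 h in bt hq0; set M := q0 t ord0 h in bt hq0.
have [tZ /(_ h) MC] := proj2 q0P t; have MZ : M \is a Num.int by move/mxOverP: tZ; apply.
have [_ /(_ h) mC] := proj2 q0P b.
have M0 : 0 < M by case/andP: mC => m0 _; exact: le_lt_trans bt.
have tb : t != b by apply: contraTneq bt => e; rewrite /m /M e ltxx.
have [||q1 [q01 q1b hq1]] := @reach_pyramid q0 h b m M q0P _ MZ MC erefl; rewrite ?lt_eqF //.
have q1P := reach_placed q0P q01.
have [||q2 [q12 q2b q2bh hq2]] := @reach_apex q1 h g b M 0 gh q1P.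
- by move=> i /hq1[].
- by left; rewrite q1b.
have q2P := reach_placed q1P q12.
have q2M i : i != b -> q2 i ord0 h = M by move=> ib; rewrite hq2 //; case: (hq1 i ib).
have hq2' i : q2 i ord0 h = M \/ q2 i ord0 h = 0.
  by have [->|ib] := eqVneq i b; [right|left; exact: q2M].
have [|||q3 [q23 q3t hq3]] := @reach_pyramid q2 h t M 0 q2P _ _ _ (q2M _ tb) hq2'.
- by rewrite gt_eqF.
- exact: rpred0.
- by rewrite lexx ler0n.
have q3P := reach_placed q2P q23.
have [||q4 [q34 q4t q4th hq4]] := @reach_apex q3 h g t 0 K gh q3P.
- by move=> i /hq3[].
- by right; rewrite q3t q2M.
exists q4; first by apply: reach_trans pq0 _; apply: reach_trans q01 _;
  apply: reach_trans q12 _; apply: reach_trans q23 _.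
move=> i; have [->//|it] := eqVneq i t; rewrite hq4 //.
have [q3h [[q2h q32]|[_ c]]] := hq3 i it.
  have [ib|ib] := eqVneq i b; first by rewrite q32 ib.
  by move: M0; rewrite -(q2M i ib) q2h ltxx.
by move=> j; have [->|jh] := eqVneq j h; [left|exact: c].
Qed.

(** On the cube this is the l1 distance to the corner x, in a form that is affine on
    the whole space. *)
Definition corner_gap x y : R :=
  \sum_j (if x ord0 j == 0 then y ord0 j else K - y ord0 j).

Lemma affine_corner_gap x : affine_fun (corner_gap x).
Proof.
apply: affine_fun_sum => j; case: eqP => _; first exact: affine_fun_coord.
by apply: affine_funB; [exact: affine_fun_cst|exact: affine_fun_coord].
Qed.

Lemma corner_gap_refl x : corner x -> corner_gap x x = 0.
Proof.
move=> xc; rewrite /corner_gap big1 // => j _.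
by case: eqP => [->//|x0]; case: (xc j) => // ->; rewrite subrr.
Qed.

Lemma corner_gap_gt0 x y : corner x -> hypercube k y -> y != x -> 0 < corner_gap x y.
Proof.
move=> xc yC yx.
have t0 j : true -> 0 <= (if x ord0 j == 0 then y ord0 j else K - y ord0 j).
  by move=> _; have /andP[] := yC j; case: eqP; rewrite ?subr_ge0.
rewrite lt_def sumr_ge0 // andbT; apply: contra_neq yx => e.
apply/rowP => j; have := psumr_eq0P t0 e (i := j) isT.
have [->//|x0] := eqVneq (x ord0 j) 0; move/eqP; rewrite subr_eq0 => /eqP <-.
by case: (xc j) => // xj; rewrite xj eqxx in x0.
Qed.

Lemma corner_site x : corner x -> site k x.
Proof.
move=> xc; split; last by move=> j; case: (xc j) => ->; rewrite lexx ler0n.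
by apply/mxOverP => a j; rewrite ord1; case: (xc j) => ->; rewrite ?rpred0 ?natr_int.
Qed.

(** The gap of w vanishes at w and is positive on p, so some coordinate a is positive
    and some c is negative.  The gap of p a is positive at w and vanishes at p a, so
    another coordinate is positive. *)
Lemma corner_insertable p w : frame p -> (forall i, corner (p i)) -> corner w ->
  (forall i, p i != w) -> insertable p w.
Proof.
move=> pF pc wc pw.
have gap z i : corner z -> p i != z -> 0 < corner_gap z (p i).
  by move=> zc; apply: corner_gap_gt0 => //; case: (corner_site (pc i)).
have sum z : \sum_i bary p i w * corner_gap z (p i) = corner_gap z w.
  by rewrite -(affine_fun_bary_comb pF) //; exact: affine_corner_gap.
have [v lv] : exists v, bary p v w != 0.
  apply: contrapT => N; have := bary_sum1 pF w; rewrite big1 => [/eqP|i _].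
    by rewrite eq_sym oner_eq0.
  by apply/eqP/negPn/negP => li; apply: N; exists i.
have [|||[a la _] [c lc _]] := @sum_eq0_terms _ _ (fun i => bary p i w)
    (fun i => corner_gap w (p i)) v.
- by move=> i; apply/ltW/gap.
- by rewrite sum corner_gap_refl.
- by rewrite mulf_neq0 // gt_eqF // gap.
have [||b lb gb] := @sum_gt0_term _ _ (fun i => bary p i w)
    (fun i => corner_gap (p a) (p i)).
- move=> i; have [->|ia] := eqVneq (p i) (p a); first by rewrite corner_gap_refl.
  by apply/ltW/gap.
- rewrite sum; apply: corner_gap_gt0 => //; first by case: (corner_site wc).
  by rewrite eq_sym.
exists a, b, c; split=> //; apply: contraTneq gb => ->.
by rewrite corner_gap_refl // ltxx.
Qed.

(** Basis exchange: every insertion of a corner is allowed, so the vertices of p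
    outside the target q are replaced one after the other. *)
Lemma reach_corner_frame p q : placed k p -> placed k q ->
  (forall i, corner (p i)) -> (forall i, corner (q i)) ->
  exists2 r, reach k p r & range r = range q.
Proof.
move=> pP qP pc qc; have [qF qS] := qP.
move: {2}#|_| (leqnn #|[pred i | p i \notin codom q]|) => n.
elim: n p pP pc => [|n IHn] p pP pc hn; have [pF pS] := pP.
  have pq i : exists j, p i = q j.
    apply/codomP; apply/negPn/negP => pi; move: hn; rewrite leqn0.
    by move/eqP/card0_eq/(_ i); rewrite !inE pi.
  exists p; first exact: reach_refl.
  apply/seteqP; split=> [x [i _ <-]|x [j _ <-]].
    by have [j ->] := pq i; exists j.
  apply: contrapT => N.
  suff /eqP : bary q j (q j) = 0 by rewrite bary_vertex // eqxx oner_eq0.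
  apply: (affine_fun_eq0 pF (affine_fun_bary q j)) => i.
  have [l pl] := pq i; rewrite pl bary_vertex //.
  by have [jl|//] := eqVneq j l; case: N; exists i => //; rewrite pl jl.
have [v hv|N] := pickP (fun i => p i \notin codom q); last first.
  by apply: IHn => //; rewrite eq_card0 // => i; rewrite inE N.
have [w lw] : exists w, bary p v (q w) != 0.
  apply: contrapT => N.
  suff /eqP : bary p v (p v) = 0 by rewrite bary_vertex // eqxx oner_eq0.
  apply: (affine_fun_eq0 qF (affine_fun_bary p v)) => i.
  by apply/eqP/negPn/negP => li; apply: N; exists i.
have pw i : p i != q w.
  apply: contraNneq hv => piw; move: lw; rewrite -piw bary_vertex //.
  have [->|_] := eqVneq v i; last by rewrite eqxx.
  by rewrite piw codom_f.
have wI := corner_insertable pF pc (qc w) pw.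
have [|||r pr rq] := IHn (replace p v (q w)).
- by apply: placed_replace.
- by move=> i; rewrite /replace; case: eqP.
- rewrite -ltnS; apply: leq_trans hn; apply: proper_card; apply/properP; split.
    apply/fintype.subsetP => j; rewrite !inE.
    by have [->|jv] := eqVneq j v; [rewrite replace_eq codom_f|rewrite replace_neq].
  by exists v; rewrite !inE ?hv // replace_eq codom_f.
by exists r => //; apply: reach_trans pr; exact: reach1.
Qed.

Definition corner_simplex : 'I_d.+1 -> point :=
  fun i => if unlift ord0 i is Some j then K *: unit_vec R j else 0.

Lemma corner_simplex_corner i : corner (corner_simplex i).
Proof.
move=> j; rewrite /corner_simplex; case: unliftP => [l _|_]; last by left; rewrite mxE.
by rewrite !mxE eqxx /=; case: eqP => _; rewrite ?mulr1 ?mulr0; [right|left].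
Qed.

Lemma corner_simplex_placed : placed k corner_simplex.
Proof.
split; last by move=> i; exact/corner_site/corner_simplex_corner.
have K0 : K != 0 by rewrite pnatr_eq0 -lt0n.
apply: frameP => c; rewrite !big_ord_recl /= => c0 cp.
have cl l : c (lift ord0 l) = 0.
  move: cp => /rowP/(_ l); rewrite !mxE summxE (bigD1 l) //= big1.
    rewrite /corner_simplex unlift_none liftK !mxE !eqxx /= mulr0 add0r addr0 mulr1.
    by move/eqP; rewrite mulf_eq0 (negbTE K0) orbF => /eqP.
  move=> j jl; rewrite /corner_simplex liftK !mxE [l == j]eq_sym (negbTE jl) andbF.
  by rewrite !mulr0.
move=> i; case: (unliftP ord0 i) => [l ->//|->].
by move: c0; rewrite big1 ?addr0.
Qed.

End Corners.

(** * Convex hulls, vertices and dimension *)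

Section Hulls.
Variables (R : realType) (d : nat).
Local Notation point := 'rV[R]_d.
Implicit Types (x y z w : point) (A C S P V W : set point).

Lemma convex_setE A : @convex_set R point A <->
  forall x y (t : R), A x -> A y -> 0 <= t <= 1 -> A (t *: x + (1 - t) *: y).
Proof.
split=> [cA x y t Ax Ay /andP[t0 t1]|cA x y t /set_mem Ax /set_mem Ay].
  have := cA x y (Itv01 t0 t1); rewrite !in_setE; exact.
by rewrite in_setE; apply: cA => //; rewrite ge0 le1.
Qed.

Lemma convex_hull_convex S x y (t : R) : convex_hull S x -> convex_hull S y ->
  0 <= t <= 1 -> convex_hull S (t *: x + (1 - t) *: y).
Proof.
move=> hx hy ht A [cA SA]; move/convex_setE: (cA); apply=> //; [exact: hx|exact: hy].
Qed.

Lemma sub_convex_hull S : S `<=` convex_hull S.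
Proof. exact: sub_gen_smallest. Qed.

Lemma convex_hull_min S C :
  (forall x y (t : R), C x -> C y -> 0 <= t <= 1 -> C (t *: x + (1 - t) *: y)) ->
  S `<=` C -> convex_hull S `<=` C.
Proof. by move=> cC; apply: smallest_sub; exact/convex_setE. Qed.

Lemma convex_hull_sub S S' : S `<=` convex_hull S' -> convex_hull S `<=` convex_hull S'.
Proof. by move=> h; apply: convex_hull_min => // x y t; exact: convex_hull_convex. Qed.

Lemma convex_hull_setU1 S x :
  convex_hull (convex_hull S `|` [set x]) = convex_hull (S `|` [set x]).
Proof.
apply/seteqP; split; apply: convex_hull_sub => y [].
- by apply: convex_hull_sub => z Sz; apply: sub_convex_hull; left.
- by move=> ->; apply: sub_convex_hull; right.
- by move=> Sy; apply: sub_convex_hull; left; exact: sub_convex_hull.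
- by move=> ->; apply: sub_convex_hull; right.
Qed.

(** Removing an extreme point from a convex set leaves a convex set. *)
Lemma vertices_convex_hull_sub W : vertices (convex_hull W) `<=` W.
Proof.
move=> v [hv ext]; apply: contrapT => nWv.
suff : convex_hull W `<=` [set x | convex_hull W x /\ x <> v] by move/(_ v hv) => -[].
apply: convex_hull_min => [x y t [hx xv] [hy yv] t01|x Wx]; last first.
  by split; [exact: sub_convex_hull|move=> xv; rewrite xv in Wx].
split; first exact: convex_hull_convex.
move=> e; have [t0|t0] := eqVneq t 0; first by move: e; rewrite t0 scale0r add0r subr0 scale1r.
have [t1|t1] := eqVneq t 1; first by move: e; rewrite t1 scale1r subrr scale0r addr0.
have t01' : 0 < t < 1 by rewrite !lt_def t0 eq_sym t1.
by have [] := ext x y t hx hy t01' (esym e).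
Qed.

(** A point of W where an affine function attains its minimum over W strictly is
    a vertex of the hull. *)
Lemma vertices_of_separation W :
  (forall w, W w -> exists2 f : point -> R, affine_fun f &
     forall w', W w' -> w' <> w -> f w < f w') ->
  vertices (convex_hull W) = W.
Proof.
move=> sep; apply/seteqP; split; first exact: vertices_convex_hull_sub.
move=> w Ww; split; first exact: sub_convex_hull.
have [f fA hf] := sep w Ww.
have fw : convex_hull W `<=` [set x | f w <= f x /\ (f x <= f w -> x = w)].
  apply: convex_hull_min => [x y t [fx ex] [fy ey] /andP[t0 t1]|x Wx] /=.
    rewrite affine_fun2 //; split; first nra.
    move=> le.
    have [t00|t00] := eqVneq t 0.
      rewrite t00 scale0r add0r subr0 scale1r; apply: ey; move: le; rewrite t00; lra.
    have tp : 0 < t by rewrite lt_def t00.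
    have xw : x = w by apply: ex; nra.
    have [t11|t11] := eqVneq t 1; first by rewrite t11 scale1r subrr scale0r addr0.
    have tp1 : t < 1 by rewrite lt_def eq_sym t11.
    have yw : y = w by apply: ey; nra.
    by rewrite xw yw -scalerDl subrKC scale1r.
  have [->|/eqP xw] := eqVneq x w; first by split.
  by have lt := hf x Wx xw; split; [exact: ltW|move=> /le_lt_trans/(_ lt); rewrite ltxx].
move=> x y t hx hy /andP[t0 t1] e.
have [fx ex] := fw x hx; have [fy ey] := fw y hy.
have := affine_fun2 x y t fA; rewrite -e => fwe.
by split; [apply: ex; nra|apply: ey; nra].
Qed.

(** If w lies outside the hull C of the other points, then the segments from w to C,
    with w itself excluded, still form a convex set. *)
Lemma vertices_irredundant W : (forall w, W w -> ~ convex_hull (W `\ w) w) ->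
  vertices (convex_hull W) = W.
Proof.
move=> irr; apply/seteqP; split; first exact: vertices_convex_hull_sub.
move=> w Ww; split; first exact: sub_convex_hull.
pose J := [set x | exists z (a : R),
  [/\ convex_hull (W `\ w) z, 0 < a <= 1 & x = w + a *: (z - w)]].
have Jw : ~ J w.
  move=> [z [a [hz /andP[a0 _] e]]]; apply: (irr w Ww).
  have : a *: (z - w) = 0 by apply: (addrI w); rewrite addr0 -e.
  move/eqP; rewrite scaler_eq0 gt_eqF //= subr_eq0 => /eqP zw.
  by rewrite -[X in convex_hull _ X]zw.
have Jconv x y (t : R) : J x -> J y -> 0 <= t <= 1 -> J (t *: x + (1 - t) *: y).
  move=> [z1 [a1 [h1 /andP[a10 a11] ->]]] [z2 [a2 [h2 /andP[a20 a21] ->]]] /andP[t0 t1].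
  pose a := t * a1 + (1 - t) * a2.
  have a0 : 0 < a by rewrite /a; nra.
  have ale : a <= 1 by rewrite /a; nra.
  have s01 : 0 <= t * a1 / a <= 1.
    rewrite divr_ge0 ?mulr_ge0 ?(ltW a10) ?(ltW a0) //= ler_pdivrMr // mul1r /a.
    by rewrite lerDl mulr_ge0 ?(ltW a20) // subr_ge0.
  exists (t * a1 / a *: z1 + (1 - t * a1 / a) *: z2), a; split.
  - exact: convex_hull_convex.
  - by rewrite a0.
  - have an0 : a != 0 by rewrite gt_eqF.
    apply/rowP => i; rewrite !mxE /a; field.
    by rewrite -/a.
have sub : convex_hull W `<=` [set x | x = w \/ J x].
  apply: convex_hull_min => [|x Wx] /=; last first.
    have [->|/eqP xw] := eqVneq x w; [by left|right].
    exists x, 1; split; rewrite ?ltr01 ?lexx //; last by rewrite scale1r subrKC.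
    by apply: sub_convex_hull; split.
  have half x (t : R) : J x -> 0 <= t <= 1 ->
      t *: x + (1 - t) *: w = w \/ J (t *: x + (1 - t) *: w).
    move=> [z [a [hz /andP[a0 a1] ->]]] /andP[t0 t1].
    have [->|tn0] := eqVneq t 0; first by left; rewrite scale0r add0r subr0 scale1r.
    have tp : 0 < t by rewrite lt_def tn0.
    right; exists z, (t * a); split=> //; first by apply/andP; split; nra.
    by apply/rowP => i; rewrite !mxE; ring.
  move=> x y t [->|Jx] [->|Jy] t01.
  - by left; rewrite -scalerDl subrKC scale1r.
  - have -> : t *: w + (1 - t) *: y = (1 - t) *: y + (1 - (1 - t)) *: w.
      by rewrite subKr addrC.
    by apply: half => //; case/andP: t01 => t0 t1; apply/andP; split; lra.
  - exact: half.
  - by right; exact: Jconv.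
move=> x y t hx hy /andP[t0 t1] e.
have w_eq (a : R) z : 0 < a -> w = a *: z + (1 - a) *: w -> z = w.
  move=> a0 /eqP; rewrite scalerBl scale1r addrCA -[X in X == _]addr0 (inj_eq (addrI w)).
  by rewrite -scalerBr eq_sym scaler_eq0 gt_eqF //= subr_eq0 => /eqP.
have t1' : 0 < 1 - t by rewrite subr_gt0.
case: (sub x hx) => [xw|Jx].
  by split=> //; apply: (w_eq _ _ t1'); rewrite {1}e xw subKr addrC.
case: (sub y hy) => [yw|Jy].
  by split=> //; apply: (w_eq t) => //; rewrite {1}e yw.
by case: Jw; rewrite e; apply: Jconv => //; apply/andP; split; exact: ltW.
Qed.

(** A finite set of points generating a polytope can be pruned until no point lies
    in the hull of the others. *)
Lemma polytope_hull_vertices P : polytope P -> P = convex_hull (vertices P).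
Proof.
move=> [V /finite_seqP[s ->] ->] {P V}.
elim/ltn_ind: {s}(size s) {-2}s (erefl (size s)) => n IHn s sn.
have [irr|] := pselect (forall w, [set` s] w -> ~ convex_hull ([set` s] `\ w) w).
  by rewrite vertices_irredundant.
move=> /existsNP[w /not_implyP[/= ws /contrapT hw]].
pose s' := [seq x <- s | x != w].
have -> : convex_hull [set` s] = convex_hull [set` s'].
  have ss : [set` s'] = [set` s] `\ w.
    apply/seteqP; split=> [x /=|x [xs /eqP xw]] /=; rewrite mem_filter.
      by move=> /andP[/eqP xw xs].
    by rewrite xw.
  rewrite ss; apply/seteqP; split; apply: convex_hull_sub => x.
    by move=> xs; have [->//|/eqP xw] := eqVneq x w; apply: sub_convex_hull.
  by move=> [xs _]; exact: sub_convex_hull.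
apply: (IHn (size s')) => //; rewrite -sn size_filter -(count_predC (pred1 w) s).
by rewrite -[X in (X < _)%N]add0n ltn_add2r -has_count has_pred1.
Qed.

Lemma affine_set_add A x0 u v : affine_set A ->
  A x0 -> A (x0 + u) -> A (x0 + v) -> A (x0 + (u + v)).
Proof.
move=> Aaff A0 Au Av.
have := Aaff _ _ 2 (Aaff _ _ 2^-1 Au Av) A0; congr (A _).
by apply/rowP => i; rewrite !mxE; field.
Qed.

Lemma affine_set_scale A x0 u (a : R) : affine_set A ->
  A x0 -> A (x0 + u) -> A (x0 + a *: u).
Proof.
move=> Aaff A0 Au; have := Aaff _ _ a Au A0; congr (A _).
by apply/rowP => i; rewrite !mxE; ring.
Qed.

Lemma affine_hull_frame S (p : 'I_d.+1 -> point) : frame p -> range p `<=` S ->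
  affine_hull S = setT.
Proof.
move=> pF pS; apply/seteqP; split=> // x _ A [Aaff SA].
have Ap i : A (p i) by apply/SA/pS; exists i.
have -> : x = p ord0 + \sum_i bary p i x *: (p i - p ord0).
  under eq_bigr do rewrite scalerBr.
  by rewrite sumrB bary_comb // -scaler_suml bary_sum1 // scale1r subrKC.
elim/big_ind: _ => [|u v|i _]; first by rewrite addr0.
  exact: affine_set_add.
by apply: affine_set_scale => //; rewrite subrKC.
Qed.

Lemma has_dim_full S : has_dim S d <-> affine_hull S = setT.
Proof.
split=> [[x0 [U [rU ->]]]|h].
  by apply/seteqP; split=> // x _ /=; apply: submx_full; rewrite /row_full rU.
exists 0, 1%:M; split; first exact: mxrank1.
by rewrite h; apply/seteqP; split=> // x _ /=; exact: submx1.
Qed.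

Lemma row_full_of_dim n (q : 'I_n -> point) :
  has_dim (convex_hull (range q)) d ->
  row_full (\matrix_i homog (q i) : 'M[R]_(n, 1 + d)).
Proof.
move/has_dim_full; set M := (\matrix_i _ : 'M[R]_(n, 1 + d)) => aff.
have all x : (homog x <= M)%MS.
  have : affine_hull (convex_hull (range q)) x by rewrite aff.
  have Aaff : affine_set [set x | (homog x <= M)%MS].
    move=> y z t /= hy hz; have -> : homog (t *: y + (1 - t) *: z)
        = t *: homog y + (1 - t) *: homog z.
      rewrite /homog !scale_row_mx add_row_mx; congr row_mx.
      by rewrite -scalerDl subrKC scale1r.
    by rewrite addmx_sub // scalemx_sub.
  move=> /(_ [set y | (homog y <= M)%MS]); apply; split=> //.
  apply: convex_hull_min; first by move=> y z t hy hz _; exact: Aaff.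
  by move=> _ [i _ <-] /=; rewrite -(rowK (fun i => homog (q i))) row_sub.
rewrite -sub1mx; apply/row_subP => i; rewrite row1.
case: (split_ordP i) => j ->{i}.
  suff -> : (delta_mx 0 (lshift d j) : 'rV[R]_(1 + d)) = homog 0 by exact: all.
  apply/rowP => l; case: (split_ordP l) => l' ->; rewrite mxE eqxx /=.
    by rewrite !ord1 eqxx homog_l.
  by rewrite homog_r mxE eq_rlshift.
suff -> : (delta_mx 0 (rshift 1 j) : 'rV[R]_(1 + d)) =
      homog (delta_mx 0 j) - homog 0.
  by rewrite addmx_sub // eqmx_opp.
apply/rowP => l; case: (split_ordP l) => l' ->;
  rewrite [LHS]mxE [RHS]mxE [X in _ + X]mxE eqxx /=.
  by rewrite [l']ord1 eq_lrshift !homog_l subrr.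
by rewrite !homog_r !mxE eqxx eq_rshift subr0.
Qed.

Lemma has_vertex_countP P n : has_vertex_count P n ->
  exists2 q : 'I_n -> point, injective q & range q = vertices P.
Proof.
rewrite /has_vertex_count => /card_esym e; have /card_bijP[f [f' ff' f'f]] := e.
pose iI (i : 'I_n) : `I_n := SigSub (mem_set (ltn_ord i : `I_n (val i))).
exists (fun i => set_val (f (iI i))).
  move=> i j /val_inj/(can_inj ff')/(congr1 val) /= ij; exact: val_inj.
apply/seteqP; split=> [x [i _ <-]|x Vx]; first exact: set_valP.
pose k := f' (SigSub (mem_set Vx)).
have kn : (val k < n)%N := set_valP k.
exists (Ordinal kn) => //; have -> : iI (Ordinal kn) = k by exact: val_inj.
by rewrite f'f.
Qed.

Lemma has_vertex_count_range P n (q : 'I_n -> point) : injective q ->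
  vertices P = range q -> has_vertex_count P n.
Proof.
move=> qinj vP; rewrite /has_vertex_count vP.
apply: card_eq_trans (card_esym (card_II (n := n))).
by apply: inj_card_eq => i j _ _; exact: qinj.
Qed.

End Hulls.

(** * Exchanges as paths of insertions and deletions *)

Section Moves.
Variables (R : realType) (d k : nat).
Hypothesis k_gt0 : (0 < k)%N.
Local Notation point := 'rV[R]_d.
Implicit Types (x y : point) (p q : 'I_d.+1 -> point) (P Q W : set point).

Lemma vertices_simplex p : frame p -> vertices (convex_hull (range p)) = range p.
Proof.
move=> pF; apply: vertices_of_separation => _ [i _ <-].
exists (fun x => -1 * bary p i x); first exact/affine_funZ/affine_fun_bary.
move=> _ [j _ <-] pji; rewrite !bary_vertex // eqxx.
by have [ij|_] := eqVneq i j; [case: pji; rewrite ij|rewrite mulr0 mulr1 ltrN10].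
Qed.

Lemma insertable_notin p x : frame p -> insertable p x -> ~ range p x.
Proof.
move=> pF [_ [_ [c [_ _ _ lc]]]] [i _ pix].
by move: lc; rewrite -pix bary_vertex // ltNge ler0n.
Qed.

(** Some barycentric coordinate is negative at x only, which cuts x off.  As two
    coordinates are positive at x, any vertex p j admits some i other than j with
    a positive coordinate at x, and a large multiple of coordinate i minus
    coordinate j cuts p j off. *)
Lemma vertices_insert p x : frame p -> insertable p x ->
  vertices (convex_hull (range p `|` [set x])) = range p `|` [set x].
Proof.
move=> pF xI; have [a [b [c [ab la lb lc]]]] := xI.
apply: vertices_of_separation => _ [[j _ <-]|->]; last first.
  exists (bary p c); first exact: affine_fun_bary.
  by move=> _ [[i _ <-]|->] // _; rewrite bary_vertex // (lt_le_trans lc).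
have [i ij li] : exists2 i, i != j & 0 < bary p i x.
  have [aj|aj] := eqVneq a j; [exists b => //|by exists a].
  by rewrite -aj eq_sym.
pose A := `|bary p j x| / bary p i x.
have A0 : 0 <= A by rewrite divr_ge0 // ltW.
exists (fun y => A * bary p i y - bary p j y).
  by apply: affine_funB; [apply: affine_funZ|]; exact: affine_fun_bary.
rewrite !bary_vertex // (negbTE ij) eqxx mulr0 sub0r => y [[l _ <-]|->] yj.
  rewrite !bary_vertex //; have [jl|_] := eqVneq j l; first by case: yj; rewrite jl.
  by rewrite subr0 (lt_le_trans (ltrN10 R)) // mulr_ge0.
by rewrite (lt_le_trans (ltrN10 R)) // subr_ge0 /A divfK ?gt_eqF // ler_norm.
Qed.

Lemma Lambda_vertex_hull W p : finite_set W -> vertices (convex_hull W) = W ->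
  (forall w, W w -> site k w) -> frame p -> range p `<=` W ->
  Lambda_vertex k (convex_hull W).
Proof.
move=> Wfin WV WS pF pW; split.
- by split; [exists W|rewrite WV => v /WS[]].
- by apply/has_dim_full/(affine_hull_frame pF) => x /pW; exact: sub_convex_hull.
- apply: convex_hull_min => [x y t hx hy /andP[t0 t1] i|x /WS[]//].
  have /andP[x0 x1] := hx i; have /andP[y0 y1] := hy i; rewrite !mxE.
  by apply/andP; split; nra.
Qed.

Lemma insertion_move_hull W x : vertices (convex_hull W) = W ->
  vertices (convex_hull (W `|` [set x])) = W `|` [set x] -> ~ W x ->
  insertion_move (convex_hull W) (convex_hull (W `|` [set x])).
Proof.
move=> WV WxV Wx; exists x; last by rewrite convex_hull_setU1.
split; last by rewrite convex_hull_setU1 WxV WV.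
move=> hx; apply: Wx; rewrite -WV.
have -> : convex_hull W = convex_hull (W `|` [set x]).
  apply/seteqP; split; apply: convex_hull_sub => y.
    by move=> Wy; apply: sub_convex_hull; left.
  by move=> [Wy|->//]; exact: sub_convex_hull.
by rewrite WxV; right.
Qed.

Definition small_polytopes : set (set point) :=
  [set P | has_vertex_count P d.+1 \/ has_vertex_count P d.+2].

Local Notation G := (induced_subgraph (Lambda R d k) small_polytopes).

Definition linked := clos_refl_trans (set point) (gedge G).

Lemma gedge_sym P Q : gedge G P Q -> gedge G Q P.
Proof. by move=> [hP hQ [LP LQ [?|?]]]; split=> //; split=> //; [right|left]. Qed.

Lemma linked_sym P Q : linked P Q -> linked Q P.
Proof.
elim=> [A B /gedge_sym|A|A B C _ BA _ CB]; [exact: rt_step|exact: rt_refl|].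
exact: rt_trans CB BA.
Qed.

Lemma simplex_gvertex p : placed k p -> gvertex G (convex_hull (range p)).
Proof.
move=> [pF pS]; have pV := vertices_simplex pF; split.
  apply: (Lambda_vertex_hull _ pV _ pF) => //; first exact: finite_image.
  by move=> _ [i _ <-].
by left; apply: has_vertex_count_range pV; exact: frame_inj.
Qed.

Lemma gedge_insert p x : placed k p -> site k x -> ~ range p x ->
  vertices (convex_hull (range p `|` [set x])) = range p `|` [set x] ->
  gedge G (convex_hull (range p)) (convex_hull (range p `|` [set x])).
Proof.
move=> pP xS px xV; have [pL pC] := simplex_gvertex pP; have [pF pS] := pP.
have qC : has_vertex_count (convex_hull (range p `|` [set x])) d.+2.
  pose q (i : 'I_d.+2) := if unlift ord0 i is Some j then p j else x.
  apply: (@has_vertex_count_range _ _ _ _ q).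
    move=> i j; rewrite /q; case: unliftP => [i' ->|->]; case: unliftP => [j' ->|->] //.
    - by move/(frame_inj pF) ->.
    - by move=> e; case: px; exists i'.
    - by move=> e; case: px; exists j'.
  rewrite xV; apply/seteqP; split=> [y [[i _ <-]|->]|_ [i _ <-]].
  - by exists (lift ord0 i) => //; rewrite /q liftK.
  - by exists ord0 => //; rewrite /q unlift_none.
  - by rewrite /q; case: unliftP => [j _|_]; [left; exists j|right].
split; [exact: pC|by right|split=> //].
  apply: (Lambda_vertex_hull _ xV _ pF) => //.
    by rewrite finite_setU; split; [exact: finite_image|exact: finite_set1].
  by move=> _ [[i _ <-]|->].
by left; apply: insertion_move_hull => //; exact: vertices_simplex.
Qed.

(** An exchange is an insertion followed by the deletion of the old vertex. *)
Lemma linked_replace p v x : placed k p -> site k x -> insertable p x ->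
  bary p v x != 0 ->
  linked (convex_hull (range p)) (convex_hull (range (replace p v x))).
Proof.
move=> pP xS xI lv; have [pF pS] := pP.
have rP := placed_replace pP xS lv; have px := insertable_notin pF xI.
have xV := vertices_insert pF xI.
have same : range (replace p v x) `|` [set p v] = range p `|` [set x].
  apply/seteqP; split=> y.
    move=> [[i _ <-]|->]; last by left; exists v.
    by rewrite /replace; case: eqP => _; [right|left; exists i].
  move=> [[i _ <-]|->]; last by left; exists v => //; rewrite replace_eq.
  have [->|iv] := eqVneq i v; first by right.
  by left; exists i => //; rewrite replace_neq.
have e1 := gedge_insert pP xS px xV.
have e2 : gedge G (convex_hull (range (replace p v x)))
                  (convex_hull (range p `|` [set x])).
  rewrite -same; apply: gedge_insert => //; last by rewrite same.
  move=> [i _]; have [->|iv] := eqVneq i v.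
    by rewrite replace_eq => xv; apply: px; exists v.
  by rewrite replace_neq // => /(frame_inj pF) iv'; rewrite iv' eqxx in iv.
exact: rt_trans (rt_step _ _ _ _ e1) (rt_step _ _ _ _ (gedge_sym e2)).
Qed.

Lemma linked_reach p q : placed k p -> reach k p q ->
  linked (convex_hull (range p)) (convex_hull (range q)).
Proof.
move=> pP; elim=> [|r v x pr IH xS xI lv]; first exact: rt_refl.
by apply: rt_trans IH _; apply: linked_replace => //; exact: reach_placed pr.
Qed.

Lemma Lambda_vertex_site P v : Lambda_vertex k P -> vertices P v -> site k v.
Proof. by move=> [[_ PZ] _ PC] Pv; split; [exact: PZ|apply: PC; case: Pv]. Qed.

(** Among d+2 points spanning the space some d+1 are affinely independent, and
    the remaining one can be deleted. *)
Lemma linked_simplex P : gvertex G P ->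
  exists2 p, placed k p & linked (convex_hull (range p)) P.
Proof.
move=> [PL [PC|PC]]; have [q qinj qV] := has_vertex_countP PC;
  have [[Ppol _] Pdim _] := PL; have PH := polytope_hull_vertices Ppol;
  rewrite -qV in PH; have Pfull : has_dim (convex_hull (range q)) d by [rewrite -PH].
  have qF : frame q by rewrite /frame -row_full_unit; exact: row_full_of_dim.
  exists q; last by rewrite -PH; exact: rt_refl.
  by split=> // i; apply: (Lambda_vertex_site PL); rewrite -qV; exists i.
have qfull := row_full_of_dim Pfull.
pose f : 'I_d.+1 -> 'I_d.+2 := fullrankfun qfull.
have finj : injective f by exact: fullrankfun_inj.
pose p := q \o f.
have pF : frame p.
  rewrite /frame; have := fullrowsub_unit qfull; congr (_ \in unitmx).
  by apply/matrixP => i j; rewrite !mxE.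
have qS i : site k (q i) by apply: (Lambda_vertex_site PL); rewrite -qV; exists i.
have pP : placed k p by split=> // i; exact: qS.
have [j hj] : exists j, [predC codom f] =i pred1 j.
  suff /eqP/mem_card1[j hj] : #|[predC codom f]| == 1%N by exists j.
  have e := cardC (mem (codom f)); rewrite card_codom // in e.
  by apply/eqP/(@addnI #|'I_d.+1|); rewrite e !card_ord addn1.
have jf i : f i != j.
  by apply/negP => fij; have := hj (f i); rewrite !inE fij codom_f.
have rq : range q = range p `|` [set q j].
  apply/seteqP; split=> [_ [i _ <-]|_ [[i _ <-]|->]]; last 2 first.
  - by exists (f i).
  - by exists j.
  have [->|ij] := eqVneq i j; first by right.
  have := hj i; rewrite !inE (negbTE ij) => /negbFE/codomP[l ->].
  by left; exists l.
exists p => //; apply: rt_step; rewrite PH rq; apply: gedge_insert => //.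
  by move=> [i _ /qinj e]; have := jf i; rewrite e eqxx.
by rewrite -rq -PH.
Qed.

End Moves.

Theorem theorem1p3 (R : realType) (d k : nat) (hd : (2 <= d)%N) (hk : (1 <= k)%N) :
  graph_connected
    (induced_subgraph (Lambda R d k)
       [set P | has_vertex_count P d.+1 \/ has_vertex_count P d.+2]).
Proof.
have cP := corner_simplex_placed R d hk.
have cC := @corner_simplex_corner R d k.
pose D := convex_hull (range (@corner_simplex R d k)).
have to_D P : gvertex (induced_subgraph (Lambda R d k) (@small_polytopes R d)) P ->
    linked k P D.
  move=> /linked_simplex[p pP pl]; apply: rt_trans (linked_sym pl) _.
  have [q pq qC] := reach_corners hk hd pP.
  have qP := reach_placed pP pq.
  have [r qr re] := reach_corner_frame qP cP qC cC.
  rewrite /D -re; apply: linked_reach => //; exact: reach_trans qr.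
split; first by exists D; exact: simplex_gvertex.
by move=> P Q hP hQ; apply: rt_trans (to_D P hP) (linked_sym (to_D Q hQ)).
Qed.
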